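(* There is a 2-category $\mathbf{Bicat}_2$ whose objects are bicategories, whose 1-cells are lax functors, and whose 2-cells are icons, with the usual composition laws. These are as follows. (1) 1-cells are composed by the usual composition of lax functors: if $F:\mathscr A\to\mathscr B$ has constraints $\varphi,\varphi^0$ and $H:\mathscr B\to\mathscr C$ has constraints $\chi,\chi^0$, then $HF$ has constraints $H(\varphi_{g,f})\circ\chi_{Fg,Ff}$ and $H(\varphi^0_A)\circ\chi^0_{FA}$. (2) The vertical composite $\beta\alpha:F\to H$ of icons $\alpha:F\to G$ and $\beta:G\to H$, where $F,G,H:\mathscr A\to\mathscr B$, is given by the composite natural transformations $F\to G\to H:\mathscr A(A,B)\to\mathscr B(FA,FB)$. (3) For an icon $\alpha:F\to G:\mathscr A\to\mathscr B$ and lax functors $K:\mathscr D\to\mathscr A$ and $H:\mathscr B\to\mathscr C$, the whiskered icon $H\alpha K:HFK\to HGK$ is given by the whiskered natural transformations $\mathscr D(D,E)\xrightarrow{K}\mathscr A(KD,KE)\overset{\alpha}{\Longrightarrow}\mathscr B(FKD,FKE)\xrightarrow{H}\mathscr C(HFKD,HFKE)$; that is, its component at a 1-cell $f$ of $\mathscr D$ is $H(\alpha_{Kf})$.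
   Context: A lax functor $F:\mathscr A\to\mathscr B$ of bicategories consists of a function $A\mapsto FA$ on objects, functors $F:\mathscr A(A,B)\to\mathscr B(FA,FB)$ on hom-categories, and 2-cells $\varphi_{g,f}:Fg.Ff\to F(gf)$, natural in $f:A\to B$ and $g:B\to C$, and $\varphi^0_A:1_{FA}\to F1_A$, satisfying the usual associativity and unit coherence conditions. The constraints $\varphi,\varphi^0$ are not required to be invertible. Icon: let $F,G:\mathscr A\to\mathscr B$ be lax functors with constraints $(\varphi,\varphi^0)$ and $(\psi,\psi^0)$ respectively, such that $FA=GA$ for all objects $A$ of $\mathscr A$. An icon $\alpha$ from $F$ to $G$ consists of, for all objects $A,B$ of $\mathscr A$, a natural transformation $\alpha:F\to G:\mathscr A(A,B)\to\mathscr B(FA,FB)$, with components 2-cells $\alpha_f:Ff\to Gf$ for 1-cells $f:A\to B$, such that: (ICON1) $\psi_{g,f}\circ(\alpha_g.\alpha_f)=\alpha_{gf}\circ\varphi_{g,f}$ for all 1-cells $f:A\to B$ and $g:B\to C$ of $\mathscr A$, where $\alpha_g.\alpha_f:Fg.Ff\to Gg.Gf$ is the horizontal composite in $\mathscr B$; (ICON2) $\alpha_{1_A}\circ\varphi^0_A=\psi^0_A$ for all objects $A$ of $\mathscr A$. There is an icon from $F$ to $G$ only if $F$ and $G$ agree on objects. *)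

(* Defs.v *)
Set Implicit Arguments.
Unset Strict Implicit.
Unset Printing Implicit Defensive.

Declare Scope cat_scope.
Delimit Scope cat_scope with cat.
Local Open Scope cat_scope.

Reserved Notation "b ∘ a" (at level 40, left associativity).
Reserved Notation "g ⋅ f" (at level 35, right associativity).
Reserved Notation "t ⊗ s" (at level 35, right associativity).

Record Category : Type := {
  obj :> Type;
  hom : obj -> obj -> Type;
  idm : forall x, hom x x;
  compose : forall x y z, hom y z -> hom x y -> hom x z
    where "b ∘ a" := (compose b a);
  compA : forall w x y z (h : hom y z) (g : hom x y) (f : hom w x),
    h ∘ (g ∘ f) = (h ∘ g) ∘ f;
  comp1m : forall x y (f : hom x y), idm y ∘ f = f;
  compm1 : forall x y (f : hom x y), f ∘ idm x = f
}.
Notation "b ∘ a" := (compose b a) : cat_scope.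
Arguments idm {c} x.

Definition is_iso (C : Category) (x y : C) (f : hom x y) : Prop :=
  exists g : hom y x, g ∘ f = idm x /\ f ∘ g = idm y.

Record Functor (C D : Category) : Type := {
  fobj :> C -> D;
  fmap : forall x y, hom x y -> hom (fobj x) (fobj y);
  fmap_id : forall x, fmap (idm x) = idm (fobj x);
  fmap_comp : forall x y z (g : hom y z) (f : hom x y),
    fmap (g ∘ f) = fmap g ∘ fmap f
}.

Definition functor_id (C : Category) : Functor C C.
Proof. refine {| fobj x := x; fmap x y f := f |}; reflexivity. Defined.

Definition functor_comp (C D E : Category) (G : Functor D E) (F : Functor C D) :
  Functor C E.
Proof.
refine {| fobj x := G (F x); fmap x y f := fmap G (fmap F f) |}.
- abstract (intros; rewrite !fmap_id; reflexivity).
- abstract (intros; rewrite !fmap_comp; reflexivity).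
Defined.

Record NatTrans (C D : Category) (F G : Functor C D) : Type := {
  ntc :> forall x, hom (F x) (G x);
  nt_nat : forall x y (f : hom x y), ntc y ∘ fmap F f = fmap G f ∘ ntc x
}.

Definition nt_id (C D : Category) (F : Functor C D) : NatTrans F F.
Proof.
refine {| ntc x := idm (F x) |}.
abstract (intros; rewrite comp1m, compm1; reflexivity).
Defined.

Definition nt_vcomp (C D : Category) (F G H : Functor C D)
  (b : NatTrans G H) (a : NatTrans F G) : NatTrans F H.
Proof.
refine {| ntc x := b x ∘ a x |}.
abstract (intros; rewrite <- compA, nt_nat, compA, nt_nat, compA; reflexivity).
Defined.

Definition nt_hcomp (C D E : Category) (F F' : Functor C D) (H H' : Functor D E)
  (b : NatTrans H H') (a : NatTrans F F') :
  NatTrans (functor_comp H F) (functor_comp H' F').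
Proof.
refine (@Build_NatTrans _ _ (functor_comp H F) (functor_comp H' F')
          (fun x => fmap H' (a x) ∘ b (F x)) _).
abstract (intros; cbn; rewrite <- compA, nt_nat, !compA, <- !fmap_comp, nt_nat;
          reflexivity).
Defined.

Definition nt_whisker (B C D E : Category) (H : Functor D E) (F G : Functor C D)
  (a : NatTrans F G) (K : Functor B C) :
  NatTrans (functor_comp H (functor_comp F K)) (functor_comp H (functor_comp G K)).
Proof.
refine (@Build_NatTrans _ _ (functor_comp H (functor_comp F K))
          (functor_comp H (functor_comp G K)) (fun x => fmap H (a (K x))) _).
abstract (intros; cbn; rewrite <- !fmap_comp, nt_nat; reflexivity).
Defined.

Record Bicategory : Type := {
  cell0 :> Type;
  cell1 : cell0 -> cell0 -> Category;
  bid : forall X, cell1 X X;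
  bcomp : forall X Y Z, cell1 Y Z -> cell1 X Y -> cell1 X Z
    where "g ⋅ f" := (bcomp g f);
  bcomp2 : forall X Y Z (g g' : cell1 Y Z) (f f' : cell1 X Y),
    hom g g' -> hom f f' -> hom (g ⋅ f) (g' ⋅ f')
    where "t ⊗ s" := (bcomp2 t s);
  bcomp2_id : forall X Y Z (g : cell1 Y Z) (f : cell1 X Y),
    idm g ⊗ idm f = idm (g ⋅ f);
  bcomp2_comp : forall X Y Z (g g' g'' : cell1 Y Z) (f f' f'' : cell1 X Y)
    (t' : hom g' g'') (t : hom g g') (s' : hom f' f'') (s : hom f f'),
    (t' ∘ t) ⊗ (s' ∘ s) = (t' ⊗ s') ∘ (t ⊗ s);

  assoc : forall W X Y Z (h : cell1 Y Z) (g : cell1 X Y) (f : cell1 W X),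
    hom ((h ⋅ g) ⋅ f) (h ⋅ (g ⋅ f));
  lunit : forall X Y (f : cell1 X Y), hom (bid Y ⋅ f) f;
  runit : forall X Y (f : cell1 X Y), hom (f ⋅ bid X) f;
  assoc_iso : forall W X Y Z (h : cell1 Y Z) (g : cell1 X Y) (f : cell1 W X),
    is_iso (assoc h g f);
  lunit_iso : forall X Y (f : cell1 X Y), is_iso (lunit f);
  runit_iso : forall X Y (f : cell1 X Y), is_iso (runit f);
  assoc_nat : forall W X Y Z (h h' : cell1 Y Z) (g g' : cell1 X Y)
    (f f' : cell1 W X) (r : hom h h') (t : hom g g') (s : hom f f'),
    assoc h' g' f' ∘ ((r ⊗ t) ⊗ s) = (r ⊗ (t ⊗ s)) ∘ assoc h g f;
  lunit_nat : forall X Y (f f' : cell1 X Y) (s : hom f f'),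
    lunit f' ∘ (idm (bid Y) ⊗ s) = s ∘ lunit f;
  runit_nat : forall X Y (f f' : cell1 X Y) (s : hom f f'),
    runit f' ∘ (s ⊗ idm (bid X)) = s ∘ runit f;
  pentagon : forall V W X Y Z (k : cell1 Y Z) (h : cell1 X Y) (g : cell1 W X)
    (f : cell1 V W),
    assoc k h (g ⋅ f) ∘ assoc (k ⋅ h) g f =
    (idm k ⊗ assoc h g f) ∘ (assoc k (h ⋅ g) f ∘ (assoc k h g ⊗ idm f));
  triangle : forall X Y Z (g : cell1 Y Z) (f : cell1 X Y),
    (idm g ⊗ lunit f) ∘ assoc g (bid Y) f = runit g ⊗ idm f
}.
Notation "g ⋅ f" := (bcomp g f) : cat_scope.
Notation "t ⊗ s" := (bcomp2 t s) : cat_scope.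
Arguments bid {b} X.

Record LaxOn (A B : Bicategory) (o : A -> B) : Type := {
  lax_map : forall X Y, Functor (cell1 X Y) (cell1 (o X) (o Y));
  lax_mu : forall X Y Z (g : cell1 Y Z) (f : cell1 X Y),
    hom (lax_map Y Z g ⋅ lax_map X Y f) (lax_map X Z (g ⋅ f));
  lax_eta : forall X, hom (bid (o X)) (lax_map X X (bid X));
  lax_mu_nat : forall X Y Z (g g' : cell1 Y Z) (f f' : cell1 X Y)
    (t : hom g g') (s : hom f f'),
    lax_mu g' f' ∘ (fmap (lax_map Y Z) t ⊗ fmap (lax_map X Y) s) =
    fmap (lax_map X Z) (t ⊗ s) ∘ lax_mu g f;
  lax_assoc : forall W X Y Z (h : cell1 Y Z) (g : cell1 X Y) (f : cell1 W X),
    fmap (lax_map W Z) (assoc h g f) ∘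
      (lax_mu (h ⋅ g) f ∘ (lax_mu h g ⊗ idm (lax_map W X f))) =
    lax_mu h (g ⋅ f) ∘ ((idm (lax_map Y Z h) ⊗ lax_mu g f) ∘
      assoc (lax_map Y Z h) (lax_map X Y g) (lax_map W X f));
  lax_lunit : forall X Y (f : cell1 X Y),
    fmap (lax_map X Y) (lunit f) ∘
      (lax_mu (bid Y) f ∘ (lax_eta Y ⊗ idm (lax_map X Y f))) =
    lunit (lax_map X Y f);
  lax_runit : forall X Y (f : cell1 X Y),
    fmap (lax_map X Y) (runit f) ∘
      (lax_mu f (bid X) ∘ (idm (lax_map X Y f) ⊗ lax_eta X)) =
    runit (lax_map X Y f)
}.
Arguments lax_map {A B o} l {X Y}.

Record LaxFunctor (A B : Bicategory) : Type := MkLax {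
  lax_ob :> A -> B;
  lax_on :> LaxOn lax_ob
}.
Arguments MkLax {A B} lax_ob lax_on.

Definition lax_on_id (A : Bicategory) : LaxOn (fun X : A => X).
Proof.
refine (@Build_LaxOn A A (fun X => X) (fun X Y => functor_id (cell1 X Y))
  (fun X Y Z g f => idm (g ⋅ f)) (fun X => idm (bid X)) _ _ _ _);
abstract (intros; cbn; rewrite ?bcomp2_id, ?comp1m, ?compm1, ?bcomp2_id,
  ?comp1m, ?compm1; reflexivity).
Defined.

Section LaxOnComp.
Variables (A B C : Bicategory) (r : B -> C) (o : A -> B).
Variables (H : LaxOn r) (F : LaxOn o).

Let m X Y : Functor (cell1 X Y) (cell1 (r (o X)) (r (o Y))) :=
  functor_comp (lax_map H) (lax_map F).

Let mu X Y Z (g : cell1 Y Z) (f : cell1 X Y) : hom (m Y Z g ⋅ m X Y f) (m X Z (g ⋅ f)) :=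
  fmap (lax_map H) (lax_mu F g f) ∘ lax_mu H (lax_map F g) (lax_map F f).

Let eta X : hom (bid (r (o X))) (m X X (bid X)) :=
  fmap (lax_map H) (lax_eta F X) ∘ lax_eta H (o X).

Lemma lax_comp_mu_nat X Y Z (g g' : cell1 Y Z) (f f' : cell1 X Y)
    (t : hom g g') (s : hom f f') :
  mu g' f' ∘ (fmap (m Y Z) t ⊗ fmap (m X Y) s) = fmap (m X Z) (t ⊗ s) ∘ mu g f.
Proof.
unfold mu; cbn.
rewrite <- compA, lax_mu_nat, !compA, <- !fmap_comp, lax_mu_nat; reflexivity.
Qed.

Let whR X Y Z (g g' g'' : @cell1 C Y Z) (f : cell1 X Y) (t' : hom g' g'') (t : hom g g') :
  (t' ∘ t) ⊗ idm f = (t' ⊗ idm f) ∘ (t ⊗ idm f).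
Proof. rewrite <- bcomp2_comp, comp1m; reflexivity. Qed.

Let whL X Y Z (g : @cell1 C Y Z) (f f' f'' : cell1 X Y) (t' : hom f' f'') (t : hom f f') :
  idm g ⊗ (t' ∘ t) = (idm g ⊗ t') ∘ (idm g ⊗ t).
Proof. rewrite <- bcomp2_comp, comp1m; reflexivity. Qed.

Let muR X Y Z (g g' : @cell1 B Y Z) (f : cell1 X Y) (t : hom g g') :
  lax_mu H g' f ∘ (fmap (lax_map H) t ⊗ idm (lax_map H f)) =
  fmap (lax_map H) (t ⊗ idm f) ∘ lax_mu H g f.
Proof. rewrite <- fmap_id; apply lax_mu_nat. Qed.

Let muL X Y Z (g : @cell1 B Y Z) (f f' : cell1 X Y) (t : hom f f') :
  lax_mu H g f' ∘ (idm (lax_map H g) ⊗ fmap (lax_map H) t) =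
  fmap (lax_map H) (idm g ⊗ t) ∘ lax_mu H g f.
Proof. rewrite <- fmap_id; apply lax_mu_nat. Qed.

Lemma lax_comp_assoc W X Y Z (h : cell1 Y Z) (g : cell1 X Y) (f : cell1 W X) :
  fmap (m W Z) (assoc h g f) ∘ (mu (h ⋅ g) f ∘ (mu h g ⊗ idm (m W X f))) =
  mu h (g ⋅ f) ∘ ((idm (m Y Z h) ⊗ mu g f) ∘ assoc (m Y Z h) (m X Y g) (m W X f)).
Proof.
unfold mu; cbn; rewrite whR, whL.
rewrite <- !compA, (compA (lax_mu H _ _) (fmap _ _ ⊗ _)), muR.
rewrite (compA (lax_mu H _ _) (_ ⊗ fmap _ _)), muL.
rewrite <- !compA, <- lax_assoc, !compA, <- !fmap_comp, <- !compA, lax_assoc.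
reflexivity.
Qed.

Lemma lax_comp_lunit X Y (f : cell1 X Y) :
  fmap (m X Y) (lunit f) ∘ (mu (bid Y) f ∘ (eta Y ⊗ idm (m X Y f))) = lunit (m X Y f).
Proof.
unfold mu, eta; cbn; rewrite whR.
rewrite <- !compA, (compA (lax_mu H _ _) (fmap _ _ ⊗ _)), muR.
rewrite !compA, <- !fmap_comp, <- !compA, lax_lunit, lax_lunit; reflexivity.
Qed.

Lemma lax_comp_runit X Y (f : cell1 X Y) :
  fmap (m X Y) (runit f) ∘ (mu f (bid X) ∘ (idm (m X Y f) ⊗ eta X)) = runit (m X Y f).
Proof.
unfold mu, eta; cbn; rewrite whL.
rewrite <- !compA, (compA (lax_mu H _ _) (_ ⊗ fmap _ _)), muL.
rewrite !compA, <- !fmap_comp, <- !compA, lax_runit, lax_runit; reflexivity.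
Qed.

Definition lax_on_comp : LaxOn (fun X => r (o X)) :=
  @Build_LaxOn A C (fun X => r (o X)) m mu eta
    lax_comp_mu_nat lax_comp_assoc lax_comp_lunit lax_comp_runit.

End LaxOnComp.

Definition lax_id (A : Bicategory) : LaxFunctor A A := MkLax _ (lax_on_id A).

Definition lax_comp (A B C : Bicategory) (H : LaxFunctor B C) (F : LaxFunctor A B) :
  LaxFunctor A C := MkLax _ (lax_on_comp H F).

Record IconOn (A B : Bicategory) (o : A -> B) (F G : LaxOn o) : Type := {
  icon_nt : forall X Y, NatTrans (@lax_map _ _ _ F X Y) (@lax_map _ _ _ G X Y);
  icon_mu : forall X Y Z (g : cell1 Y Z) (f : cell1 X Y),
    lax_mu G g f ∘ (icon_nt Y Z g ⊗ icon_nt X Y f) =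
    icon_nt X Z (g ⋅ f) ∘ lax_mu F g f;
  icon_eta : forall X, icon_nt X X (bid X) ∘ lax_eta F X = lax_eta G X
}.
Arguments icon_nt {A B o F G} i {X Y}.

Definition icon_on_id (A B : Bicategory) (o : A -> B) (F : LaxOn o) : IconOn F F.
Proof.
refine {| icon_nt X Y := nt_id (lax_map F) |};
abstract (intros; cbn; rewrite ?bcomp2_id, ?comp1m, ?compm1; reflexivity).
Defined.

Definition icon_on_vcomp (A B : Bicategory) (o : A -> B) (F G H : LaxOn o)
  (b : IconOn G H) (a : IconOn F G) : IconOn F H.
Proof.
refine {| icon_nt X Y := nt_vcomp (icon_nt b) (icon_nt a) |}; intros; cbn.
- abstract (rewrite bcomp2_comp, compA, icon_mu, <- compA, icon_mu, compA; reflexivity).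
- abstract (rewrite <- compA, !icon_eta; reflexivity).
Defined.

Definition icon_on_hcomp (A B C : Bicategory) (r : B -> C) (o : A -> B)
  (H H' : LaxOn r) (F F' : LaxOn o) (b : IconOn H H') (a : IconOn F F') :
  IconOn (lax_on_comp H F) (lax_on_comp H' F').
Proof.
refine (@Build_IconOn _ _ _ (lax_on_comp H F) (lax_on_comp H' F')
          (fun X Y => nt_hcomp (icon_nt b) (icon_nt a)) _ _); intros; cbn.
- abstract (rewrite bcomp2_comp, <- compA, (compA (lax_mu H' _ _)), lax_mu_nat,
    <- compA, icon_mu, !compA, <- fmap_comp, icon_mu, fmap_comp, <- !compA;
    f_equal; rewrite !compA, nt_nat; reflexivity).
- abstract (rewrite <- compA, (compA (icon_nt b _)), nt_nat, <- compA, icon_eta,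
    compA, <- fmap_comp, icon_eta; reflexivity).
Defined.

(** [lax_along p G] is [G] regarded as having the object function [o]. *)
Definition lax_along (A B : Bicategory) (o o' : A -> B) (p : o = o') :
  LaxOn o' -> LaxOn o :=
  match p with eq_refl => fun G => G end.

(** Agreement on objects is equality of object functions; under functional
    extensionality this is the same as [forall X, F X = G X]. *)
Record Icon (A B : Bicategory) (F G : LaxFunctor A B) : Type := MkIcon {
  icon_ob : lax_ob F = lax_ob G;
  icon_on : IconOn (lax_on F) (lax_along icon_ob (lax_on G))
}.

Definition icon_of (A B : Bicategory) (o : A -> B) (F G : LaxOn o) (a : IconOn F G) :
  Icon (MkLax o F) (MkLax o G) :=
  @MkIcon A B (MkLax o F) (MkLax o G) eq_refl a.

Definition icon_id (A B : Bicategory) (F : LaxFunctor A B) : Icon F F :=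
  @MkIcon A B F F eq_refl (icon_on_id F).

Definition icon_vcomp_along (A B : Bicategory) (o1 o2 o3 : A -> B)
  (p : o1 = o2) (q : o2 = o3) :
  forall (F : LaxOn o1) (G : LaxOn o2) (H : LaxOn o3),
    IconOn G (lax_along q H) -> IconOn F (lax_along p G) ->
    IconOn F (lax_along (eq_trans p q) H) :=
  match q in _ = o3 return
    forall (F : LaxOn o1) (G : LaxOn o2) (H : LaxOn o3),
      IconOn G (lax_along q H) -> IconOn F (lax_along p G) ->
      IconOn F (lax_along (eq_trans p q) H)
  with eq_refl =>
    match p in _ = o2 return
      forall (F : LaxOn o1) (G H : LaxOn o2),
        IconOn G H -> IconOn F (lax_along p G) -> IconOn F (lax_along p H)
    with eq_refl => fun F G H b a => icon_on_vcomp b a end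
  end.

Definition icon_vcomp (A B : Bicategory) (F G H : LaxFunctor A B)
  (b : Icon G H) (a : Icon F G) : Icon F H :=
  MkIcon (icon_vcomp_along (icon_on b) (icon_on a)).

Definition ob_comp_eq (A B C : Type) (r r' : B -> C) (o o' : A -> B)
  (q : r = r') (p : o = o') : (fun X => r (o X)) = (fun X => r' (o' X)) :=
  match q, p with eq_refl, eq_refl => eq_refl end.

Definition icon_hcomp_along (A B C : Bicategory) (r r' : B -> C) (o o' : A -> B)
  (q : r = r') (p : o = o') :
  forall (H : LaxOn r) (H' : LaxOn r') (F : LaxOn o) (F' : LaxOn o'),
    IconOn H (lax_along q H') -> IconOn F (lax_along p F') ->
    IconOn (lax_on_comp H F) (lax_along (ob_comp_eq q p) (lax_on_comp H' F')) :=
  match q, p with eq_refl, eq_refl => fun H H' F F' b a => icon_on_hcomp b a end.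

Definition icon_hcomp (A B C : Bicategory) (H H' : LaxFunctor B C)
  (F F' : LaxFunctor A B) (b : Icon H H') (a : Icon F F') :
  Icon (lax_comp H F) (lax_comp H' F') :=
  @MkIcon A C (lax_comp H F) (lax_comp H' F') _
    (icon_hcomp_along (icon_on b) (icon_on a)).

Record TwoCatData : Type := {
  tc_ob : Type;
  tc_hom1 : tc_ob -> tc_ob -> Type;
  tc_hom2 : forall X Y, tc_hom1 X Y -> tc_hom1 X Y -> Type;
  tc_id1 : forall X, tc_hom1 X X;
  tc_comp : forall X Y Z, tc_hom1 Y Z -> tc_hom1 X Y -> tc_hom1 X Z;
  tc_id2 : forall X Y (f : tc_hom1 X Y), tc_hom2 f f;
  tc_vcomp : forall X Y (f g h : tc_hom1 X Y),
    tc_hom2 g h -> tc_hom2 f g -> tc_hom2 f h;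
  tc_hcomp : forall X Y Z (g g' : tc_hom1 Y Z) (f f' : tc_hom1 X Y),
    tc_hom2 g g' -> tc_hom2 f f' -> tc_hom2 (tc_comp g f) (tc_comp g' f')
}.
Arguments tc_id1 : clear implicits.

(** A 2-cell together with its source and target.  Equations between 2-cells
    whose boundaries agree only propositionally are stated in this type; such
    an equation includes the equality of the boundaries. *)
Record BoundedCell (D : TwoCatData) (X Y : tc_ob D) : Type := MkBounded {
  bc_src : tc_hom1 X Y;
  bc_tgt : tc_hom1 X Y;
  bc_cell : tc_hom2 bc_src bc_tgt
}.

Record is_two_category (D : TwoCatData) : Prop := {
  tc_vcompA : forall (X Y : tc_ob D) (f g h k : tc_hom1 X Y)
    (c : tc_hom2 h k) (b : tc_hom2 g h) (a : tc_hom2 f g),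
    tc_vcomp c (tc_vcomp b a) = tc_vcomp (tc_vcomp c b) a;
  tc_vcomp1m : forall (X Y : tc_ob D) (f g : tc_hom1 X Y) (a : tc_hom2 f g),
    tc_vcomp (tc_id2 g) a = a;
  tc_vcompm1 : forall (X Y : tc_ob D) (f g : tc_hom1 X Y) (a : tc_hom2 f g),
    tc_vcomp a (tc_id2 f) = a;

  tc_hcomp_id : forall (X Y Z : tc_ob D) (g : tc_hom1 Y Z) (f : tc_hom1 X Y),
    tc_hcomp (tc_id2 g) (tc_id2 f) = tc_id2 (tc_comp g f);
  tc_interchange : forall (X Y Z : tc_ob D) (g g' g'' : tc_hom1 Y Z)
    (f f' f'' : tc_hom1 X Y) (b' : tc_hom2 g' g'') (b : tc_hom2 g g')
    (a' : tc_hom2 f' f'') (a : tc_hom2 f f'),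
    tc_hcomp (tc_vcomp b' b) (tc_vcomp a' a) =
    tc_vcomp (tc_hcomp b' a') (tc_hcomp b a);

  tc_compA : forall (W X Y Z : tc_ob D) (h : tc_hom1 Y Z) (g : tc_hom1 X Y)
    (f : tc_hom1 W X),
    tc_comp h (tc_comp g f) = tc_comp (tc_comp h g) f;
  tc_comp1m : forall (X Y : tc_ob D) (f : tc_hom1 X Y), tc_comp (tc_id1 D Y) f = f;
  tc_compm1 : forall (X Y : tc_ob D) (f : tc_hom1 X Y), tc_comp f (tc_id1 D X) = f;

  tc_hcompA : forall (W X Y Z : tc_ob D) (h h' : tc_hom1 Y Z) (g g' : tc_hom1 X Y)
    (f f' : tc_hom1 W X) (c : tc_hom2 h h') (b : tc_hom2 g g') (a : tc_hom2 f f'),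
    MkBounded (tc_hcomp c (tc_hcomp b a)) = MkBounded (tc_hcomp (tc_hcomp c b) a);
  tc_hcomp1m : forall (X Y : tc_ob D) (f f' : tc_hom1 X Y) (a : tc_hom2 f f'),
    MkBounded (tc_hcomp (tc_id2 (tc_id1 D Y)) a) = MkBounded a;
  tc_hcompm1 : forall (X Y : tc_ob D) (f f' : tc_hom1 X Y) (a : tc_hom2 f f'),
    MkBounded (tc_hcomp a (tc_id2 (tc_id1 D X))) = MkBounded a
}.

Definition Bicat2 : TwoCatData := {|
  tc_ob := Bicategory;
  tc_hom1 := LaxFunctor;
  tc_hom2 := Icon;
  tc_id1 := lax_id;
  tc_comp := lax_comp;
  tc_id2 := icon_id;
  tc_vcomp := icon_vcomp;
  tc_hcomp := icon_hcomp
|}.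

(* Main.v *)
(** All the 2-category axioms hold componentwise in the hom-categories of the
    target bicategory; what has to be controlled is that lax functors and icons
    are determined by their components.  Composition of lax functors is
    associative and unital only up to the coherence proofs carried by the
    records, so the components of two such composites live in types that agree
    only propositionally; they are compared as arrows bundled with their
    endpoints. *)

Require Import Defs.
From Stdlib Require Import FunctionalExtensionality ProofIrrelevance.
Local Open Scope cat_scope.

Set Implicit Arguments.
Unset Strict Implicit.

Record Arrow (C : Category) : Type := MkArrow {
  arr_src : C;
  arr_tgt : C;
  arr : hom arr_src arr_tgt
}.

Lemma MkArrow_eq (C : Category) (x y : C) (f g : hom x y) :
  f = g -> MkArrow f = MkArrow g.
Proof. intros ->; reflexivity. Qed.

(** With both endpoints fixed, the dependent-pair equalities can be stripped off one at a time,
    since proof irrelevance gives uniqueness of identity proofs. *)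
Lemma MkArrow_inj (C : Category) (x y : C) (f g : hom x y) :
  MkArrow f = MkArrow g -> f = g.
Proof.
intro e; injection e; intro e1.
apply inj_pairT2 in e1; apply inj_pairT2 in e1; exact e1.
Qed.

Lemma functor_ext (C D : Category) (F G : Functor C D) :
  (forall x, F x = G x) ->
  (forall x y (f : hom x y), MkArrow (fmap F f) = MkArrow (fmap G f)) ->
  F = G.
Proof.
destruct F as [fo fm fi fc], G as [go gm gi gc]; cbn; intros e0 e1.
assert (e : fo = go) by (extensionality x; apply e0); destruct e.
assert (e : fm = gm)
  by (extensionality x; extensionality y; extensionality f;
      apply MkArrow_inj, e1).
destruct e; f_equal; apply proof_irrelevance.
Qed.

Lemma nt_ext (C D : Category) (F G : Functor C D) (a b : NatTrans F G) :
  (forall x, a x = b x) -> a = b.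
Proof.
destruct a as [a na], b as [b nb]; cbn; intro e0.
assert (e : a = b) by (extensionality x; apply e0); destruct e.
f_equal; apply proof_irrelevance.
Qed.

(** The endpoints of the constraints depend on the local functors, so the constraints are compared
    as bundled arrows; once the local functors are identified, [MkArrow_inj] unbundles them. *)
Lemma lax_on_ext (A B : Bicategory) (o : A -> B) (F G : LaxOn o) :
  (forall X Y, @lax_map _ _ _ F X Y = @lax_map _ _ _ G X Y) ->
  (forall X Y Z (g : cell1 Y Z) (f : cell1 X Y),
     MkArrow (lax_mu F g f) = MkArrow (lax_mu G g f)) ->
  (forall X, MkArrow (lax_eta F X) = MkArrow (lax_eta G X)) ->
  F = G.
Proof.
destruct F as [m mu eta n a l r], G as [m' mu' eta' n' a' l' r']; cbn.
intros e0 e1 e2.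
assert (e : m = m') by (extensionality X; extensionality Y; apply e0).
destruct e.
assert (e : mu = mu')
  by (extensionality X; extensionality Y; extensionality Z;
      extensionality g; extensionality f; apply MkArrow_inj, e1).
destruct e.
assert (e : eta = eta') by (extensionality X; apply MkArrow_inj, e2).
destruct e; f_equal; apply proof_irrelevance.
Qed.

Lemma icon_on_ext (A B : Bicategory) (o : A -> B) (F G : LaxOn o)
    (a b : IconOn F G) :
  (forall X Y (f : cell1 X Y), icon_nt a f = icon_nt b f) -> a = b.
Proof.
destruct a as [a am ae], b as [b bm be]; cbn; intro e0.
assert (e : a = b)
  by (extensionality X; extensionality Y; apply nt_ext; intro f; apply e0).
destruct e; f_equal; apply proof_irrelevance.
Qed.

(** Serves the associativity and unit laws of horizontal composition: after the sources and targets
    are identified, only the components remain to be compared. *)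
Lemma bounded_icon_ext (A B : Bicategory) (o : A -> B) (F F' G G' : LaxOn o)
    (a : IconOn F G) (a' : IconOn F' G') :
  F = F' -> G = G' ->
  (forall X Y (f : cell1 X Y),
     MkArrow (icon_nt a f) = MkArrow (icon_nt a' f)) ->
  @MkBounded Bicat2 A B (MkLax o F) (MkLax o G) (icon_of a) =
  @MkBounded Bicat2 A B (MkLax o F') (MkLax o G') (icon_of a').
Proof.
intros eF eG; destruct eF, eG; intro e.
assert (ea : a = a') by (apply icon_on_ext; intros; apply MkArrow_inj, e).
destruct ea; reflexivity.
Qed.

(** Both bracketings have convertible object functions, so the equation is well typed without
    transport; the constraints differ only by functoriality of [H] and associativity. *)
Lemma lax_on_compA (A B C D : Bicategory) (q : C -> D) (r : B -> C) (o : A -> B)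
    (H : LaxOn q) (G : LaxOn r) (F : LaxOn o) :
  lax_on_comp H (lax_on_comp G F) = lax_on_comp (lax_on_comp H G) F.
Proof.
apply lax_on_ext; intros; [apply functor_ext; reflexivity | |];
  apply MkArrow_eq; cbn; rewrite fmap_comp, compA; reflexivity.
Qed.

Lemma lax_on_comp1m (A B : Bicategory) (o : A -> B) (F : LaxOn o) :
  lax_on_comp (lax_on_id B) F = F.
Proof.
apply lax_on_ext; intros; [apply functor_ext; reflexivity | |];
  apply MkArrow_eq; apply compm1.
Qed.

Lemma lax_on_compm1 (A B : Bicategory) (o : A -> B) (F : LaxOn o) :
  lax_on_comp F (lax_on_id A) = F.
Proof.
apply lax_on_ext; intros; [apply functor_ext; reflexivity | |];
  apply MkArrow_eq; cbn; rewrite fmap_id; apply comp1m.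
Qed.

(** Opening the lax functors turns their object functions into variables, so the object equalities
    inside icons can be eliminated and every transport along them reduces away. *)
Ltac strict_objects :=
  repeat match goal with F : LaxFunctor _ _ |- _ => destruct F as [? F] end;
  repeat match goal with a : Icon _ _ |- _ => destruct a as [? a] end;
  cbn in *;
  repeat match goal with e : _ = _ |- _ => destruct e end;
  cbn in *.

Lemma Bicat2_is_two_category : is_two_category Bicat2.
Proof.
split; cbn; intros; strict_objects.
(* Both sides now carry [eq_refl] on objects, hence lie in the image of [icon_of]. *)
- apply (f_equal (@icon_of _ _ _ _ _)), icon_on_ext; intros; apply compA.
- apply (f_equal (@icon_of _ _ _ _ _)), icon_on_ext; intros; apply comp1m.
- apply (f_equal (@icon_of _ _ _ _ _)), icon_on_ext; intros; apply compm1.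
- apply (f_equal (@icon_of _ _ _ _ _)), icon_on_ext; intros; cbn.
  rewrite fmap_id; apply comp1m.
- apply (f_equal (@icon_of _ _ _ _ _)), icon_on_ext; intros; cbn.
  (* Interchange is naturality of the outer icon [b'] at a component of the inner icon [a]. *)
  rewrite fmap_comp, <- !compA; f_equal; rewrite !compA, nt_nat; reflexivity.
- exact (f_equal (MkLax _) (lax_on_compA h g f)).
- exact (f_equal (MkLax _) (lax_on_comp1m f)).
- exact (f_equal (MkLax _) (lax_on_compm1 f)).
- apply (bounded_icon_ext (lax_on_compA h g f) (lax_on_compA h' g' f')).
  intros; apply MkArrow_eq; cbn; rewrite fmap_comp, compA; reflexivity.
- apply (bounded_icon_ext (lax_on_comp1m f) (lax_on_comp1m f')).
  intros; apply MkArrow_eq, compm1.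
- apply (bounded_icon_ext (lax_on_compm1 f) (lax_on_compm1 f')).
  intros; apply MkArrow_eq; cbn; rewrite fmap_id; apply comp1m.
Qed.

Theorem theorem3p2 :
  is_two_category Bicat2
  /\ (* (1) composition of lax functors *)
  (forall (A B C : Bicategory) (H : LaxFunctor B C) (F : LaxFunctor A B),
     let HF : LaxFunctor A C := @tc_comp Bicat2 A B C H F in
     (forall X : A, HF X = H (F X)) /\
     (forall X Y : A, @lax_map _ _ _ HF X Y = functor_comp (lax_map H) (lax_map F)) /\
     (forall (X Y Z : A) (g : cell1 Y Z) (f : cell1 X Y),
        lax_mu HF g f =
        fmap (lax_map H) (lax_mu F g f) ∘ lax_mu H (lax_map F g) (lax_map F f)) /\
     (forall X : A,
        lax_eta HF X = fmap (lax_map H) (lax_eta F X) ∘ lax_eta H (F X)))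
  /\ (* (2) vertical composition of icons *)
  (forall (A B : Bicategory) (o : A -> B) (F G H : LaxOn o)
          (b : IconOn G H) (a : IconOn F G),
     let ba : Icon (MkLax o F) (MkLax o H) :=
       @tc_vcomp Bicat2 A B (MkLax o F) (MkLax o G) (MkLax o H) (icon_of b) (icon_of a) in
     exists c : IconOn F H,
       ba = icon_of c /\
       forall X Y : A, @icon_nt _ _ _ _ _ c X Y = nt_vcomp (icon_nt b) (icon_nt a))
  /\ (* (3) whiskering of icons *)
  (forall (A B C D : Bicategory) (o : A -> B) (H : LaxFunctor B C)
          (F G : LaxOn o) (a : IconOn F G) (K : LaxFunctor D A),
     let HFK : LaxFunctor D C := lax_comp H (lax_comp (MkLax o F) K) in
     let HGK : LaxFunctor D C := lax_comp H (lax_comp (MkLax o G) K) in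
     let HaK : Icon HFK HGK :=
       @tc_hcomp Bicat2 D B C H H _ _ (@tc_id2 Bicat2 B C H)
         (@tc_hcomp Bicat2 D A B (MkLax o F) (MkLax o G) K K
            (icon_of a) (@tc_id2 Bicat2 D A K)) in
     exists c : IconOn (lax_on HFK) (lax_on HGK),
       HaK = icon_of c /\
       (forall X Y : D,
          @icon_nt _ _ _ _ _ c X Y = nt_whisker (lax_map H) (icon_nt a) (lax_map K)) /\
       (forall (X Y : D) (f : cell1 X Y),
          icon_nt c f = fmap (lax_map H) (icon_nt a (lax_map K f)))).
Proof.
split; [exact Bicat2_is_two_category | split; [| split]].
- intros; repeat split.
- intros; exists (icon_on_vcomp b a); split; reflexivity.
- intros.
  (* Whiskering is horizontal composition with identity icons; their components contribute only
     identity 2-cells, which the unit laws and [fmap_id] remove. *)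
  set (c := icon_on_hcomp (icon_on_id H) (icon_on_hcomp a (icon_on_id K))).
  assert (whiskered : forall (X Y : D) (f : cell1 X Y),
            icon_nt c f = fmap (lax_map H) (icon_nt a (lax_map K f))).
  { intros; cbn; rewrite compm1, fmap_id, comp1m; reflexivity. }
  exists c; split; [reflexivity | split; [| exact whiskered]].
  intros; apply nt_ext; intro f; apply whiskered.
Qed.
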